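(* Let $n\ge 4$ and let $U_n$ be any connected unicyclic graph on $n$ vertices. Then \[ RRR(U_n)\ \ge\ \begin{cases} 1+2\sqrt{n-2}, & 4\le n\le 16,\\[2pt] 1+3\sqrt{2}+\sqrt{n-5}, & n\ge 17.\end{cases} \] For $4\le n\le 16$, equality holds if and only if $U_n\cong S_n^{+}$; for $n\ge 17$, equality holds if and only if $U_n\cong H_n$.
   Context: All graphs are simple, finite, undirected and connected; $d_u$ denotes the degree of vertex $u$. A connected graph on $n$ vertices is unicyclic if it has exactly $n$ edges. The reduced reciprocal Randić index of a graph $G$ is \[ RRR(G)=\sum_{uv\in E(G)}\sqrt{(d_u-1)(d_v-1)}. \] $S_n^{+}$ denotes the unicyclic graph obtained from the star $K_{1,n-1}$ by adding an edge between two of its pendent (degree-one) vertices (so $RRR(S_n^+)=1+2\sqrt{n-2}$). For $n\ge 6$, $H_n$ denotes the $n$-vertex unicyclic graph consisting of a triangle on vertices $y,a,b$, a vertex $w$ adjacent to $y$, a vertex $v$ adjacent to $w$, and $n-5$ pendent vertices all adjacent to $v$ (so $d_y=3$, $d_a=d_b=d_w=2$, $d_v=n-4$, and $RRR(H_n)=1+3\sqrt{2}+\sqrt{n-5}$). *)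

(* Defs.v *)
From HB Require Import structures.
From mathcomp Require Import all_boot all_order all_algebra all_fingroup.
Set Implicit Arguments. Unset Strict Implicit. Unset Printing Implicit Defensive.
Import Order.TTheory GRing.Theory Num.Theory.

Definition simple_graph (n : nat) (e : rel 'I_n) : Prop :=
  symmetric e /\ irreflexive e.

Definition graph_connected (n : nat) (e : rel 'I_n) : Prop :=
  forall x y : 'I_n, connect e x y.

Definition deg (n : nat) (e : rel 'I_n) (u : 'I_n) : nat := #|[pred v | e u v]|.

Definition edges (n : nat) (e : rel 'I_n) : {set 'I_n * 'I_n} :=
  [set p : 'I_n * 'I_n | (p.1 < p.2)%N && e p.1 p.2].

Definition unicyclic (n : nat) (e : rel 'I_n) : Prop :=
  simple_graph e /\ graph_connected e /\ #|edges e| = n.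

Definition RRR (R : rcfType) (n : nat) (e : rel 'I_n) : R :=
  \sum_(p in edges e)
     Num.sqrt (((deg e p.1).-1 * (deg e p.2).-1)%:R : R).

Definition isomorphic (n : nat) (e g : rel 'I_n) : Prop :=
  exists f : {perm 'I_n}, forall x y : 'I_n, e x y = g (f x) (f y).

(* S_n^+ : star centred at 0 with the extra edge {1,2} *)
Definition Splus_rel (i j : nat) : bool :=
  (i != j) && [|| i == 0%N, j == 0%N | ((i == 1%N) && (j == 2%N)) || ((i == 2%N) && (j == 1%N))].
Definition Splus (n : nat) : rel 'I_n := fun x y => Splus_rel x y.

(* H_n : triangle y=0,a=1,b=2; w=3 adjacent to y; v=4 adjacent to w;
   pendants 5..n-1 adjacent to v *)
Definition H_half (i j : nat) : bool :=
  [|| (i == 0%N) && (j == 1%N), (i == 0%N) && (j == 2%N), (i == 1%N) && (j == 2%N),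
      (i == 0%N) && (j == 3%N), (i == 3%N) && (j == 4%N) | (i == 4%N) && (5 <= j)%N].
Definition Hn (n : nat) : rel 'I_n := fun x y => H_half x y || H_half y x.

(* Main.v *)
Require Import Defs.
From HB Require Import structures.
From mathcomp Require Import all_boot all_order all_algebra all_fingroup.
From mathcomp Require Import zify ring lra.
Import Order.TTheory GRing.Theory Num.Theory.
Local Open Scope ring_scope.
Set Implicit Arguments.
Unset Strict Implicit.
Unset Printing Implicit Defensive.

(** Only the core matters: the subgraph on the vertices of degree at least 2.
    For a core vertex v let k be its degree in the core, l the number of leaves
    at v and r = k + l - 1 its reduced degree; in the core the k's sum to twice
    the number of vertices.  Since (sqrt r - 1)(sqrt r' - 1) >= 0 on every edge,
    RRR is at least the sum of k sqrt r - 1 over the core.  By subadditivity of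
    sqrt (x + 1) - 1 all leaves beyond the obligatory ones (one at each vertex
    with k = 1) can be moved to a single vertex, and a vertex with k >= 2 then
    costs k sqrt (k - 1) - 1 while using up 2k - 3 of the n units.
    - If no k exceeds 2, the core is a cycle and the triangle S_n^+ is optimal.
    - Otherwise the linearised bound is at least 1 + 3 sqrt 2 + sqrt (n - 5),
      with equality for H_n only, unless the core is a triangle with one pendent
      edge; there the linearisation is too weak and RRR is bounded directly.
    The two values cross between n = 16 and n = 17. *)

(** * Square root inequalities and the numerical comparisons *)

Section SquareRoots.
Variable R : rcfType.

Lemma ler_of_sqr (a b : R) : 0 <= b -> a ^+ 2 <= b ^+ 2 -> a <= b.
Proof.
move=> b0 ab; case: (lerP 0 a) => a0; last exact: le_trans (ltW a0) b0.
by rewrite -(@ler_pXn2r _ 2) ?nnegrE.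
Qed.

Lemma ltr_of_sqr (a b : R) : 0 <= b -> a ^+ 2 < b ^+ 2 -> a < b.
Proof.
move=> b0 ab; case: (lerP 0 a) => a0; last exact: lt_le_trans a0 b0.
by rewrite -(@ltr_pXn2r _ 2) ?nnegrE.
Qed.

Definition sqrtn (k : nat) : R := Num.sqrt k%:R.

Lemma sqr_sqrtn k : sqrtn k ^+ 2 = k%:R.
Proof. by rewrite sqr_sqrtr ?ler0n. Qed.

Lemma sqrtn_ge0 k : 0 <= sqrtn k.
Proof. exact: sqrtr_ge0. Qed.

Lemma sqrtn0 : sqrtn 0 = 0.
Proof. exact: sqrtr0. Qed.

Lemma sqrtn1 : sqrtn 1 = 1.
Proof. exact: sqrtr1. Qed.

Lemma ler_sqrtn a b : (sqrtn a <= sqrtn b) = (a <= b)%N.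
Proof. by rewrite ler_sqrt ?ler_nat ?ler0n. Qed.

Lemma ltr_sqrtn a b : (sqrtn a < sqrtn b) = (a < b)%N.
Proof. by rewrite !ltNge ler_sqrtn -ltnNge. Qed.

Lemma sqrtn_ge1 k : (0 < k)%N -> 1 <= sqrtn k.
Proof. by rewrite -sqrtn1 ler_sqrtn. Qed.

(** The bounds are consecutive continued fraction convergents of sqrt 2; those for sqrt 3 below are
    of the same kind. *)
Lemma sqrtn2_bounds : 41 / 29 <= sqrtn 2 <= 99 / 70.
Proof. have := sqr_sqrtn 2; have := sqrtn_ge0 2 => h0 h2; apply/andP; split; nra. Qed.

Lemma sqrtn3_bounds : 71 / 41 <= sqrtn 3 <= 26 / 15.
Proof. have := sqr_sqrtn 3; have := sqrtn_ge0 3 => h0 h2; apply/andP; split; nra. Qed.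

(** With A = a + 1 and B = b + 1, the squares of sqrt A + sqrt B - 1 and of sqrt (A + B - 1) differ
    by 2 (sqrt A - 1)(sqrt B - 1). This is the subadditivity of sqrt (x + 1) - 1. *)
Lemma sqrtn_merge a b : sqrtn (a + b).+1 + 1 <= sqrtn a.+1 + sqrtn b.+1.
Proof.
have hA := sqrtn_ge1 (ltn0Sn a); have hB := sqrtn_ge1 (ltn0Sn b).
have hS := sqrtn_ge0 (a + b).+1.
have := sqr_sqrtn (a + b).+1; have := sqr_sqrtn a.+1; have := sqr_sqrtn b.+1.
rewrite -!natr1 natrD; nra.
Qed.

Lemma sqrtn_merge_lt a b : (0 < a)%N -> (0 < b)%N ->
  sqrtn (a + b).+1 + 1 < sqrtn a.+1 + sqrtn b.+1.
Proof.
move=> a0 b0.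
have hA : 1 < sqrtn a.+1 by rewrite -sqrtn1 ltr_sqrtn.
have hB : 1 < sqrtn b.+1 by rewrite -sqrtn1 ltr_sqrtn.
have hS := sqrtn_ge0 (a + b).+1.
have := sqr_sqrtn (a + b).+1; have := sqr_sqrtn a.+1; have := sqr_sqrtn b.+1.
rewrite -!natr1 natrD; nra.
Qed.

Lemma sqrtn_sum_merge (T : finType) (P : pred T) (a : T -> nat) :
  sqrtn (\sum_(i | P i) a i)%N.+1 - 1 <= \sum_(i | P i) (sqrtn (a i).+1 - 1).
Proof.
elim/big_ind2: _ => [|x u y v hx hy|//]; first by rewrite sqrtn1 subrr.
have := sqrtn_merge u v; lra.
Qed.

Lemma sqrtn_add_half a b : (0 < a)%N -> sqrtn (a + b) <= sqrtn a + b%:R / 2.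
Proof.
move=> /sqrtn_ge1 hA; have hS := sqrtn_ge0 (a + b).
have hb : 0 <= b%:R :> R by rewrite ler0n.
have := sqr_sqrtn (a + b); have := sqr_sqrtn a; rewrite natrD; nra.
Qed.

Lemma sqrtn_add_half_lt a b : (0 < a)%N -> (0 < b)%N ->
  sqrtn (a + b) < sqrtn a + b%:R / 2.
Proof.
move=> /sqrtn_ge1 hA b0; have hS := sqrtn_ge0 (a + b).
have hb : 0 < b%:R :> R by rewrite ltr0n.
have := sqr_sqrtn (a + b); have := sqr_sqrtn a; rewrite natrD; nra.
Qed.

(** Detaching l leaves from a vertex of core degree k = c + 2 saves more than sqrt (l + 1) - 1. With
    X, Y, Z as in the proof and D = k, X^2 - Y^2 = l = Z^2 - 1, while X <= D Z and Y < D give X + Y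
    < D (Z + 1); dividing leaves Z - 1 < D (X - Y). *)
Lemma sqrtn_gain_lt c l : (0 < l)%N ->
  c.+2%:R * sqrtn c.+1 + (sqrtn l.+1 - 1) < c.+2%:R * sqrtn (c.+1 + l).
Proof.
move=> l0.
have hl : 0 < l%:R :> R by rewrite ltr0n.
have hc : 0 <= c%:R :> R by rewrite ler0n.
set X := sqrtn (c.+1 + l); set Y := sqrtn c.+1; set Z := sqrtn l.+1.
have X2 : X ^+ 2 = c%:R + 1 + l%:R by rewrite sqr_sqrtn natrD natr1.
have Y2 : Y ^+ 2 = c%:R + 1 by rewrite sqr_sqrtn natr1.
have Z2 : Z ^+ 2 = l%:R + 1 by rewrite sqr_sqrtn natr1.
have -> : c.+2%:R = c%:R + 2 :> R by rewrite -natr1 -natr1; ring.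
have X0 : 0 <= X by exact: sqrtn_ge0.
have Y0 : 0 <= Y by exact: sqrtn_ge0.
have Z1 : 1 <= Z by exact: sqrtn_ge1.
have XY : Y < X by rewrite ltr_sqrtn; lia.
set D := c%:R + 2.
have XD : X <= D * Z.
  apply: ler_of_sqr; first by rewrite /D; nra.
  rewrite exprMn X2 Z2 /D; nra.
have YD : Y < D by apply: ltr_of_sqr; rewrite ?Y2 /D; nra.
have k : (X - Y) * (X + Y) = (Z - 1) * (Z + 1) by nra.
have k2 : (Z - 1) * (Z + 1) < D * (X - Y) * (Z + 1).
  by rewrite -k mulrAC [X in _ < X]mulrC ltr_pM2l; nra.
have Zp : 0 < Z + 1 by lra.
move: k2; rewrite (ltr_pM2r Zp) mulrBr; lra.
Qed.

Lemma sqrtn_gain c l :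
  c.+2%:R * sqrtn c.+1 + (sqrtn l.+1 - 1) <= c.+2%:R * sqrtn (c.+1 + l).
Proof.
case: l => [|l]; last exact/ltW/sqrtn_gain_lt.
by rewrite addn0 sqrtn1 subrr addr0.
Qed.

(** For n >= 5 and x = sqrt (n - 5), squaring turns the claim into x^2 < 2 + 2 sqrt 2 x, that is x <
    2 + sqrt 2. The square of 2 + sqrt 2 lies between 11 and 12, which puts the crossing between n =
    16 and n = 17. *)
Lemma small_case_gap n : (n <= 16)%N ->
  2 * sqrtn (n - 2) < 3 * sqrtn 2 + sqrtn (n - 5).
Proof.
(* Here [n - 5] is 0 by truncation or exactly. *)
move=> n16; have [n5|n5] := leqP n 5.
  have : sqrtn (n - 2) <= sqrtn 3 by rewrite ler_sqrtn; lia.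
  case/andP: sqrtn2_bounds; case/andP: sqrtn3_bounds; have := sqrtn_ge0 (n - 5); lra.
have [k kE] : exists k, n = (k + 5)%N by exists (n - 5)%N; lia.
rewrite kE addnK (_ : k + 5 - 2 = k + 3)%N; last by lia.
have hk : k%:R <= 11 :> R by rewrite ler_nat; lia.
have := sqr_sqrtn (k + 3); have := sqr_sqrtn k; rewrite natrD.
have := sqr_sqrtn 2; have := sqrtn_ge0 k; have := sqrtn_ge0 (k + 3).
case/andP: sqrtn2_bounds.
move: (sqrtn 2) (sqrtn k) (sqrtn (k + 3)) => s x y.
move=> sl su y0 x0 s2 x2 y2.
(* sqrt 11 < 10/3 < 2 + sqrt 2. *)
have xu : x <= 10 / 3 by apply: ler_of_sqr; lra.
apply: ltr_of_sqr; [lra|nra].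
Qed.

Lemma large_case_gap n : (17 <= n)%N ->
  3 * sqrtn 2 + sqrtn (n - 5) < 2 * sqrtn (n - 2).
Proof.
move=> h1; have [k kE] : exists k, n = (k + 5)%N by exists (n - 5)%N; lia.
rewrite kE addnK (_ : k + 5 - 2 = k + 3)%N; last by lia.
have hk : 12 <= k%:R :> R by rewrite ler_nat; lia.
have := sqr_sqrtn (k + 3); have := sqr_sqrtn k; rewrite natrD.
have := sqr_sqrtn 2; have := sqrtn_ge0 k; have := sqrtn_ge0 (k + 3).
case/andP: sqrtn2_bounds.
move: (sqrtn 2) (sqrtn k) (sqrtn (k + 3)) => s x y.
move=> sl su y0 x0 s2 x2 y2.
(* 2 + sqrt 2 < 24/7 < sqrt 12. *)
have xu : 24 / 7 <= x by apply: ler_of_sqr; lra.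
apply: ltr_of_sqr; [lra|nra].
Qed.

(** With x = sqrt q, squaring leaves 4 x^2 < t (4 x + x^2). At t = 2 this says x < 4, which q <= 12
    guarantees, and the right side grows with t. *)
Lemma paw_small_case t q : (2 <= t)%N -> (0 < q)%N -> (t + q <= 14)%N ->
  2 * sqrtn (t + q) < sqrtn t * (2 + sqrtn q).
Proof.
move=> ht hq htq.
have : 2 <= t%:R :> R by rewrite ler_nat.
have : q%:R <= 12 :> R by rewrite ler_nat; lia.
have := sqr_sqrtn (t + q); have := sqr_sqrtn t; have := sqr_sqrtn q; rewrite natrD.
have := sqrtn_ge0 (t + q); have := sqrtn_ge1 hq; have := sqrtn_ge0 t.
move: (sqrtn (t + q)) (sqrtn q) (sqrtn t) => y x u.
move=> u0 x1 y0 x2 u2 y2 q12 t2.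
have xu : x < 4 by apply: ltr_of_sqr; lra.
apply: ltr_of_sqr; first by apply: mulr_ge0; lra.
rewrite !exprMn y2 u2 -x2.
have h1 : 0 < x * (4 - x) by apply: mulr_gt0; lra.
have h2 : 0 <= (t%:R - 2) * (4 * x + x ^+ 2).
  by apply: mulr_ge0; [lra | rewrite addr_ge0 ?sqr_ge0 ?mulr_ge0; lra].
lra.
Qed.

(** For t >= 5 the term 2 sqrt t alone beats 3 sqrt 2, and t q >= t + q - 3 follows from (t - 1)(q -
    1) >= 0. The values t = 2, 3, 4 force q to be large, and rational bounds on the roots settle
    them one by one. *)
Lemma paw_large_case t q : (2 <= t)%N -> (0 < q)%N -> (15 <= t + q)%N ->
  3 * sqrtn 2 + sqrtn (t + q - 3) < sqrtn t * (2 + sqrtn q).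
Proof.
move=> ht hq htq.
have tq : [|| 5 <= t, (t == 2) && (13 <= q), (t == 3) && (12 <= q)
            | (t == 4) && (11 <= q)]%N by lia.
have [k kE] : exists k, (t + q = k + 3)%N by exists (t + q - 3)%N; lia.
have kR : t%:R + q%:R = k%:R + 3 :> R by rewrite -natrD kE natrD.
rewrite kE addnK.
have := sqr_sqrtn k; have := sqr_sqrtn t; have := sqr_sqrtn q.
have := sqrtn_ge0 k; have := sqrtn_ge1 hq; have := sqrtn_ge0 t.
set y := sqrtn k; set x := sqrtn q; set u := sqrtn t.
move=> u0 x1 y0 x2 u2 y2.
have q1 : 1 <= q%:R :> R by rewrite ler1n.
have /andP[sl su] := sqrtn2_bounds.
have /andP[sl3 su3] := sqrtn3_bounds.
have y_le_x : (t <= 3)%N -> y <= x.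
  by rewrite -(@ler_nat R) => t3; apply: ler_of_sqr; lra.
case/or4P: tq => [t5|/andP[/eqP tE q_ge]|/andP[/eqP tE q_ge]|/andP[/eqP tE q_ge]];
  try rewrite -(@ler_nat R) in q_ge.
- rewrite -(@ler_nat R) in t5.
  have u5 : 11 / 5 <= u by apply: ler_of_sqr; lra.
  have : y <= u * x.
    apply: ler_of_sqr; first by apply: mulr_ge0; lra.
    have : 0 <= (t%:R - 1) * (q%:R - 1) :> R by apply: mulr_ge0; lra.
    by rewrite exprMn y2 u2 x2; lra.
  by lra.
- have x36 : 18 / 5 <= x by apply: ler_of_sqr; lra.
  have := y_le_x; rewrite /u tE => /(_ isT).
  have : 0 <= (sqrtn 2 - 41 / 29) * (x - 1) by apply: mulr_ge0; lra.
  by lra.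
- have x36 : 33 / 10 <= x by apply: ler_of_sqr; lra.
  have := y_le_x; rewrite /u tE => /(_ isT).
  have : 0 <= (sqrtn 3 - 71 / 41) * x by apply: mulr_ge0; lra.
  by lra.
- have x36 : 33 / 10 <= x by apply: ler_of_sqr; lra.
  have t4 : t%:R = 4 :> R by rewrite tE.
  have yx : y <= x + 1 / 4 by apply: ler_of_sqr; lra.
  rewrite /u tE.
  have -> : sqrtn 4 = 2 by rewrite /sqrtn (natrX _ 2 2) sqrtr_sqr normr_nat.
  by lra.
Qed.

End SquareRoots.

(** * Cost of a single core vertex *)

Section CoreWeights.
Variable R : rcfType.

(** The term of a vertex in the linearised bound when it carries only its obligatory leaves. For k =
    1 there is one such leaf, so the reduced degree is 1 and the term is 0, not the -1 that the
    general formula would give. *)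
Definition core_weight (k : nat) : R :=
  if k == 1%N then 0 else k%:R * sqrtn R k.-1 - 1.

(* A unit of n is worth at most 1/2, by [sqrtn_add_half].  Truncated subtraction
   makes the number of units vanish for [k = 1]. *)
Definition core_gain (k : nat) : R := core_weight k - (2 * k - 3)%:R / 2.

Lemma core_gainE k : core_gain k.+2 = k.+2%:R * (sqrtn R k.+1 - 1) + 1 / 2.
Proof.
rewrite /core_gain /core_weight /= (_ : 2 * k.+2 - 3 = 2 * k + 1)%N; last by lia.
by rewrite natrD natrM -natr1 -natr1; field.
Qed.

Lemma core_gain1 : core_gain 1 = 0.
Proof. by rewrite /core_gain /core_weight /= mul0r subrr. Qed.

Lemma core_gain2 : core_gain 2 = 1 / 2.
Proof. by rewrite core_gainE sqrtn1 subrr mulr0 add0r. Qed.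

Lemma core_gain3 : core_gain 3 = 3 * sqrtn R 2 - 5 / 2.
Proof. by rewrite core_gainE; field. Qed.

Lemma core_gain_ge j k : (j <= k)%N -> core_gain j.+2 <= core_gain k.+2.
Proof.
move=> jk; rewrite !core_gainE lerD2r ler_pM ?ler0n ?ler_nat //.
  by rewrite subr_ge0 sqrtn_ge1.
by rewrite lerD2r ler_sqrtn.
Qed.

(** In the one-branching case with two subdividing vertices, anything above 3 sqrt 2 - 2 suffices;
    16/5 leaves room. *)
Lemma core_gain4 : 16 / 5 <= core_gain 4.
Proof. rewrite core_gainE; have /andP[] := sqrtn3_bounds R; lra. Qed.

(** For k = 1 both sides agree, one leaf being obligatory; for k >= 2 this is [sqrtn_gain]. *)
Lemma core_term_ge k l : (0 < k)%N -> (1 < k + l)%N ->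
  core_weight k + (sqrtn R (l - (k == 1)%N).+1 - 1)
    <= k%:R * sqrtn R (k + l).-1 - 1.
Proof.
case: k => [//|[_ l1|k _ _]].
  rewrite /core_weight /= add0r mul1r (_ : (l - 1).+1 = l)%N; last by lia.
  by [].
rewrite /core_weight /= subn0; have := sqrtn_gain R k l; rewrite addSn /=; lra.
Qed.

Lemma core_term_gt k l : (1 < k)%N -> (0 < l)%N ->
  core_weight k + (sqrtn R (l - (k == 1)%N).+1 - 1)
    < k%:R * sqrtn R (k + l).-1 - 1.
Proof.
case: k => [//|[//|k _ l0]].
rewrite /core_weight /= subn0; have := sqrtn_gain_lt R k l0; rewrite addSn /=; lra.
Qed.

End CoreWeights.

(** * Minimising the linearised bound over core degrees and leaf numbers *)

Section DegreeSequences.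
Variables (R : rcfType) (T : finType) (C : {set T}) (d l : T -> nat) (n : nat).
Hypothesis d_gt0 : forall v, v \in C -> (0 < d v)%N.
Hypothesis dl_gt1 : forall v, v \in C -> (1 < d v + l v)%N.
Hypothesis sum_d : (\sum_(v in C) d v = 2 * #|C|)%N.
Hypothesis sum_l : (#|C| + \sum_(v in C) l v = n)%N.

Definition branching := [set v in C | (2 < d v)%N].
Definition subdividing := [set v in C | d v == 2%N].
(** The sum of sqrt r + sqrt r' - 1 over the core edges, regrouped by vertices: the core has as many
    edges as vertices, so each vertex takes one of the -1 terms. *)
Definition linear_bound : R :=
  \sum_(v in C) ((d v)%:R * sqrtn R (d v + l v).-1 - 1).

(** Gains, units and d - 1 reduced by one as needed all vanish suitably at core degree 1, so
    vertices of that degree drop out of each of these sums. *)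
Lemma big_core (V : Type) (idx : V) (op : Monoid.com_law idx) (F : nat -> V) :
  F 1%N = idx ->
  \big[op/idx]_(v in C) F (d v) =
  op (\big[op/idx]_(v in branching) F (d v)) (\big[op/idx]_(v in subdividing) F 2%N).
Proof.
clear dl_gt1 sum_d sum_l; move=> F1.
rewrite (bigID (fun v => (2 < d v)%N)) /=; congr (op _ _).
  by apply: eq_bigl => v; rewrite inE.
rewrite (bigID (fun v => d v == 2%N)) /= [X in op _ X]big1 ?Monoid.mulm1.
  rewrite (eq_bigr (fun=> F 2%N)) => [|v /andP[_ /eqP->//]].
  by apply: eq_bigl => v; rewrite inE; case: (v \in C) => //=; lia.
move=> v /andP[/andP[vC dv2] dv]; have := d_gt0 vC => d0.
by rewrite (_ : d v = 1%N) //; lia.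
Qed.

Lemma core_sum_gain :
  \sum_(v in C) core_gain R (d v) =
  \sum_(v in branching) core_gain R (d v) + #|subdividing|%:R / 2.
Proof.
rewrite (big_core _ (core_gain1 R)) core_gain2 sumr_const /=.
by rewrite mul1r -[_ *+ #|_|]mulr_natl.
Qed.

Lemma core_sum_units :
  (\sum_(v in C) (2 * d v - 3) =
   \sum_(v in branching) (2 * d v - 3) + #|subdividing|)%N.
Proof.
by rewrite (@big_core _ _ addn (fun k => 2 * k - 3)%N) //= sum1_card.
Qed.

Lemma card_core :
  (#|C| = \sum_(v in branching) (d v).-1 + #|subdividing|)%N.
Proof.
clear sum_l; have := @big_core _ _ addn predn erefl; rewrite /= sum1_card => <-.
have : (\sum_(v in C) (d v).-1 + \sum_(v in C) 1 = \sum_(v in C) d v)%N.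
  by rewrite -big_split /=; apply: eq_bigr => v /d_gt0; lia.
rewrite sum_d sum1_card; lia.
Qed.

(** The budget: at each vertex the surplus leaves and the units add up to l + 2 d - 3, where for d =
    1 the obligatory leaf makes up for the truncation. Summing with [sum_d] leaves |C| plus all
    leaves, which is n. *)
Lemma core_sum_rest :
  (\sum_(v in C) (l v - (d v == 1%N)) + \sum_(v in C) (2 * d v - 3) = n)%N.
Proof.
have : (\sum_(v in C) (l v - (d v == 1%N)) + \sum_(v in C) (2 * d v - 3)
        + \sum_(v in C) 3 = \sum_(v in C) l v + \sum_(v in C) (2 * d v))%N.
  rewrite -!big_split /=; apply: eq_bigr => v vC.
  by have := d_gt0 vC; have := dl_gt1 vC; case: eqP => [->|]; lia.
rewrite sum_nat_const -big_distrr /= sum_d; lia.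
Qed.

Lemma core_sum_split :
  \sum_(v in C) core_weight R (d v) +
  (sqrtn R (\sum_(v in C) (l v - (d v == 1)))%N.+1 - 1) <= linear_bound.
Proof.
have h := sqrtn_sum_merge R (mem C) (fun v => l v - (d v == 1))%N.
apply: (le_trans (lerD (lexx _) h)); rewrite -big_split /=.
by apply: ler_sum => v vC; apply: core_term_ge; rewrite ?d_gt0 ?dl_gt1.
Qed.

(** Used for the equality case, where it forbids leaves at vertices of core degree at least 2. *)
Lemma core_sum_split_lt v : v \in C -> (1 < d v)%N -> (0 < l v)%N ->
  \sum_(v in C) core_weight R (d v) +
  (sqrtn R (\sum_(v in C) (l v - (d v == 1)))%N.+1 - 1) < linear_bound.
Proof.
move=> vC d1 l0; have h := sqrtn_sum_merge R (mem C) (fun v => l v - (d v == 1))%N.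
apply: (le_lt_trans (lerD (lexx _) h)); rewrite -big_split /=.
rewrite /linear_bound (bigD1 v) //= [X in _ < X](bigD1 v) //=.
apply: ltr_leD; first exact: core_term_gt.
by apply: ler_sum => u /andP[uC _]; apply: core_term_ge; rewrite ?d_gt0 ?dl_gt1.
Qed.

(** Six units is what the core of H_n uses: three for y and one for each of a, b, w. Every further
    unit contributes 1/2 to the weights, at least as much as it can add to the root by
    [sqrtn_add_half]. *)
Lemma core_weight_gain : (6 <= \sum_(v in C) (2 * d v - 3))%N ->
  \sum_(v in C) core_gain R (d v) + 2 + sqrtn R (n - 5) <=
  \sum_(v in C) core_weight R (d v) +
  (sqrtn R (\sum_(v in C) (l v - (d v == 1)))%N.+1 - 1).
Proof.
have := core_sum_rest; rewrite sumrB -mulr_suml -natr_sum.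
move: (\sum_(v in C) (l v - _))%N (\sum_(v in C) (2 * d v - _))%N => r u ru u6.
have -> : (n - 5 = r.+1 + (u - 6))%N by lia.
have := sqrtn_add_half R (u - 6) (ltn0Sn r); rewrite natrB //; lra.
Qed.

(** By [core_weight_gain] it remains to show that the total gain is at least 3 sqrt 2 - 1. The last
    hypothesis excludes the triangle with one pendent edge, whose gain is 1/2 too small. *)
Lemma branching_bound :
  branching != set0 ->
  (forall y, branching = [set y] -> (2 <= #|subdividing|)%N) ->
  (forall y, branching = [set y] -> d y = 3%N -> (3 <= #|subdividing|)%N) ->
  1 + 3 * sqrtn R 2 + sqrtn R (n - 5) <= linear_bound /\
  (linear_bound = 1 + 3 * sqrtn R 2 + sqrtn R (n - 5) ->
   exists y, [/\ branching = [set y], d y = 3%N, #|subdividing| = 3%N &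
     forall v, v \in C -> (1 < d v)%N -> l v = 0%N]).
Proof.
move=> B0 S2 S3; have /andP[s2l s2u] := sqrtn2_bounds R.
have dB v : v \in branching -> (2 < d v)%N by rewrite inE => /andP[].
have gB v : v \in branching -> 3 * sqrtn R 2 - 5 / 2 <= core_gain R (d v).
  move/dB; case: (d v) => [//|[//|[//|k]]] _.
  by rewrite -core_gain3 core_gain_ge.
have uB v : v \in branching -> (3 <= 2 * d v - 3)%N by move/dB; lia.
have [B2|] := ltnP 1 #|branching|.
  have U6 : (6 <= \sum_(v in C) (2 * d v - 3))%N.
    rewrite core_sum_units; have := leq_sum (index_enum T) uB; rewrite sum_nat_const; lia.
  (* Two branching vertices give at least 6 sqrt 2 - 5, and 3 sqrt 2 > 4. *)
  have G : \sum_(v in C) core_gain R (d v) > 3 * sqrtn R 2 - 1.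
    rewrite core_sum_gain; have := ler_sum (index_enum T) gB.
    rewrite sumr_const -mulr_natl.
    have : 2 <= #|branching|%:R :> R by rewrite ler_nat.
    have : 0 <= #|subdividing|%:R :> R by rewrite ler0n.
    nra.
  have := core_weight_gain U6; have := core_sum_split => h1 h2.
  by split; [lra | move=> hE; exfalso; lra].
rewrite leq_eqVlt ltnS leqn0 cards_eq0 (negPf B0) orbF => /cards1P[y By].
have yB : y \in branching by rewrite By set11.
have := S2 _ By; have := S3 _ By; have := dB _ yB => dy {}S3 {}S2.
have U6 : (6 <= \sum_(v in C) (2 * d v - 3))%N.
  rewrite core_sum_units By big_set1; lia.
have := core_weight_gain U6; have := core_sum_split => h1.
rewrite core_sum_gain By big_set1 => h2.
have S2R : 2 <= #|subdividing|%:R :> R by rewrite ler_nat.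
(* For degree at least 4 the gain is at least 16/5 + 1, so equality is impossible. *)
have [d4|d3] := ltnP 3 (d y).
  have : 16 / 5 <= core_gain R (d y).
    move: d4; case: (d y) => [//|[//|[//|[//|k]]]] _.
    exact: le_trans (core_gain4 R) (core_gain_ge R _).
  by split; [lra | move=> hE; exfalso; lra].
have dy3 : d y = 3%N by lia.
move: h2; rewrite dy3 core_gain3 => h2; have := S3 dy3; rewrite -(@ler_nat R) => S3R.
split; first by lra.
move=> hE; exists y; split=> //.
  (* Each subdividing vertex beyond the third would add 1/2 to the gain. *)
  apply/eqP; rewrite eqn_leq (S3 dy3) andbT -(@ler_nat R); lra.
move=> v vC dv; apply/eqP; rewrite -leqn0 leqNgt; apply/negP => lv.
have := core_sum_split_lt vC dv lv; lra.
Qed.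

(** Core degrees at most 2 with average 2 are all 2. All leaves merge at one vertex, and each cycle
    vertex beyond three adds 1 to the bound but at most 1/2 to sqrt (n - 2), which is counted twice.
    Both inequalities are strict unless the cycle is a triangle with leaves at one vertex only. *)
Lemma cycle_bound :
  branching = set0 -> (3 <= #|C|)%N ->
  1 + 2 * sqrtn R (n - 2) <= linear_bound /\
  (linear_bound = 1 + 2 * sqrtn R (n - 2) ->
   #|C| = 3%N /\
   forall u v, u \in C -> v \in C -> u != v -> l u = 0%N \/ l v = 0%N).
Proof.
move=> B0 C3.
have d2 v : v \in C -> d v = 2%N.
  have dle u : u \in C -> (d u <= 2)%N.
    move=> uC; have : u \notin branching by rewrite B0 inE.
    by rewrite inE uC /= -leqNgt.
  move=> vC; apply/eqP; rewrite eqn_leq dle //= leqNgt; apply/negP => lt2.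
  have : (\sum_(u in C) d u < \sum_(u in C) 2)%N.
    rewrite (bigD1 v) //= [X in (_ < X)%N](bigD1 v) //=.
    have := @leq_sum _ (index_enum T) (fun u => (u \in C) && (u != v)) d (fun=> 2%N).
    move=> /(_ (fun u => _)) h; rewrite -addSn leq_add // h //.
    by move=> u /andP[/dle].
  by rewrite sum_nat_const sum_d mulnC ltnn.
have FE : linear_bound = \sum_(v in C) (sqrtn R (l v).+1 - 1) *+ 2 + #|C|%:R.
  rewrite -sumr_const -big_split /=; apply: eq_bigr => v vC.
  by rewrite (d2 _ vC) add2n /=; ring.
rewrite sumrMnl in FE.
have Ss := sqrtn_sum_merge R (mem C) l.
have C3R : 3 <= #|C|%:R :> R by rewrite ler_nat.
have nE : (n - 2 = (\sum_(v in C) l v).+1 + (#|C| - 3))%N by lia.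
have := sqrtn_add_half R (#|C| - 3) (ltn0Sn (\sum_(v in C) l v)).
rewrite -nE natrB // => hh.
split; first by rewrite FE; lra.
move=> hE; rewrite FE in hE.
have C3E : #|C| = 3%N.
  apply/eqP; rewrite eqn_leq C3 andbT leqNgt; apply/negP => C4.
  have := @sqrtn_add_half_lt R _ (#|C| - 3) (ltn0Sn (\sum_(v in C) l v)).
  rewrite subn_gt0 -nE natrB // => /(_ C4); lra.
split=> // u v uC vC uv; case: (posnP (l u)) => [|lu]; first by left.
right; apply/eqP; rewrite -leqn0 leqNgt; apply/negP => lv.
(* Two vertices with leaves are merged strictly, then merged with the rest. *)
have := sqrtn_merge_lt R lu lv.
set P := fun i => (i \in C) && (i != u) && (i != v).
have := sqrtn_sum_merge R P l.
have sE : (\sum_(i in C) l i = (l u + l v) + \sum_(i | P i) l i)%N.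
  by rewrite (bigD1 u) //= (bigD1 v) ?vC 1?eq_sym ?uv //= addnA.
have := sqrtn_merge R (l u + l v) (\sum_(i | P i) l i); rewrite -sE.
move: hE; rewrite (bigD1 u) //= (bigD1 v) ?vC 1?eq_sym ?uv //= C3E -/P.
have -> : (n - 2 = (\sum_(v in C) l v).+1)%N by lia.
lra.
Qed.

End DegreeSequences.

(** * Edge sums as sums over ordered adjacent pairs *)

Section EdgeSums.
Variables (n : nat) (e : rel 'I_n).
Hypothesis simple_e : simple_graph e.

(** [edges] lists each edge once, with increasing ends; swapping the ends gives the remaining
    ordered pairs. Sums over ordered pairs can be regrouped by vertices. *)
Lemma big_edges (V : Type) (idx : V) (op : Monoid.com_law idx)
    (F : 'I_n -> 'I_n -> V) : (forall x y, F x y = F y x) ->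
  \big[op/idx]_x \big[op/idx]_(y | e x y) F x y =
  op (\big[op/idx]_(p in edges e) F p.1 p.2) (\big[op/idx]_(p in edges e) F p.1 p.2).
Proof.
move=> Fsym; have [e_sym e_irr] := simple_e.
rewrite pair_big_dep /= (bigID (fun p : 'I_n * 'I_n => (p.1 < p.2)%N)) /=.
congr (op _ _); first by apply: eq_bigl => p; rewrite inE andbC.
rewrite (reindex (fun p : 'I_n * 'I_n => (p.2, p.1))) /=; last first.
  by exists (fun p => (p.2, p.1)) => -[].
apply: eq_big => [[x y]|[x y] _] /=; last exact: Fsym.
rewrite inE /= e_sym -leqNgt leq_eqVlt andbC.
case: (ltnP x y) => // xy; rewrite ?orbT // orbF.
by case: eqP => // /val_inj ->; rewrite e_irr.
Qed.

Lemma RRR_double (R : rcfType) :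
  RRR R e *+ 2 =
  \sum_x \sum_(y | e x y) sqrtn R (deg e x).-1 * sqrtn R (deg e y).-1.
Proof.
rewrite big_edges => [|x y]; last exact: mulrC.
rewrite mulr2n; congr (_ + _);
by apply: eq_bigr => p _; rewrite /sqrtn -sqrtrM ?ler0n // natrM.
Qed.

Lemma degE x : deg e x = (\sum_(y | e x y) 1)%N.
Proof. by rewrite sum1_card. Qed.

Lemma sum_deg : (\sum_x deg e x = 2 * #|edges e|)%N.
Proof.
under eq_bigr => x _ do rewrite degE.
by rewrite (@big_edges _ _ addn (fun _ _ => 1%N)) //= sum1_card mul2n addnn.
Qed.

End EdgeSums.

(** * The core and the leaves of a unicyclic graph *)

Section Core.
Variables (n : nat) (e : rel 'I_n).
Hypothesis n_ge4 : (4 <= n)%N.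
Hypothesis unicyclic_e : unicyclic e.

Let e_sym : symmetric e := unicyclic_e.1.1.

Definition core : {set 'I_n} := [set v | (1 < deg e v)%N].
Definition core_deg (v : 'I_n) : nat := #|[set u in core | e v u]|.
Definition leaf_deg (v : 'I_n) : nat := #|[set u in ~: core | e v u]|.

Lemma deg_split v : deg e v = (core_deg v + leaf_deg v)%N.
Proof.
rewrite /deg /core_deg /leaf_deg -!sum1_card (bigID (mem core)) /=.
by congr addn; apply: eq_bigl => u; rewrite !inE andbC.
Qed.

(** Connectedness in the form used below: a configuration is excluded by exhibiting a closed set
    that is too small. *)
Lemma closed_setT (S : {set 'I_n}) x :
  x \in S -> (forall u v, u \in S -> e u v -> v \in S) -> S = setT.
Proof.
move=> xS cl; apply/setP => y; rewrite inE.
have clS : closed e (mem S).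
  by apply: intro_closed => [|u v euv uS]; [exact: sym_connect_sym | exact: cl euv].
by rewrite -(closed_connect clS (unicyclic_e.2.1 x y)).
Qed.

Lemma deg_gt0 v : (0 < deg e v)%N.
Proof.
rewrite lt0n; apply/negP => /eqP /card0_eq v0.
have cl u w : u \in [set v] -> e u w -> w \in [set v].
  by move=> /set1P-> evw; have := v0 w; rewrite inE evw.
have := congr1 (fun S : {set 'I_n} => #|S|) (closed_setT (set11 v) cl).
by rewrite cards1 cardsT card_ord; lia.
Qed.

Lemma leaf_neighbour_uniq y z w : y \notin core -> e y z -> e y w -> w = z.
Proof.
rewrite inE -leqNgt => y1 eyz eyw.
have /cards1P[t tE] : #|[set w | e y w]| == 1%N.
  by rewrite cardsE -[#|_|]/(deg e y) eqn_leq y1 deg_gt0.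
have : w \in [set w | e y w] by rewrite inE.
have : z \in [set w | e y w] by rewrite inE.
by rewrite tE => /set1P-> /set1P->.
Qed.

(** Two adjacent leaves would form a whole component, but n >= 4. *)
Lemma leaf_neighbour x u : x \notin core -> e x u -> u \in core.
Proof.
move=> xC exu; apply/negPn/negP => uC.
have cl y w : y \in [set x; u] -> e y w -> w \in [set x; u].
  case/set2P=> -> eyw; rewrite !inE.
    by rewrite (leaf_neighbour_uniq xC exu eyw) eqxx orbT.
  by rewrite e_sym in exu; rewrite (leaf_neighbour_uniq uC exu eyw) eqxx.
have := congr1 (fun S : {set 'I_n} => #|S|) (closed_setT (set21 x u) cl).
by rewrite cards2 cardsT card_ord; case: (x != u) => /=; lia.
Qed.

(** Each leaf has exactly one neighbour, and that neighbour is in the core, so exchanging the sums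
    counts every leaf once. *)
Lemma sum_leaf_deg : (#|core| + \sum_(v in core) leaf_deg v = n)%N.
Proof.
have -> : (\sum_(v in core) leaf_deg v = #|~: core|)%N.
  under eq_bigr => v _ do rewrite /leaf_deg -sum1_card.
  rewrite (exchange_big_dep (mem (~: core))) /=; last first.
    by move=> v u _; rewrite inE => /andP[].
  rewrite -sum1_card; apply: eq_bigr => u uL.
  have uC : u \notin core by move: uL; rewrite inE.
  transitivity (deg e u); last first.
    by have := deg_gt0 u; move: uC; rewrite inE -leqNgt; lia.
  rewrite degE; apply: eq_bigl => v; rewrite !inE e_sym.
  case evu: (e u v); rewrite ?andbF //=.
  by have := leaf_neighbour uC evu; rewrite inE => ->; move: uC; rewrite inE => ->.
by rewrite cardsC card_ord.
Qed.

(** The degrees sum to 2 n; removing the leaves and the edges to them takes off 2 for each leaf. *)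
Lemma sum_core_deg : (\sum_(v in core) core_deg v = 2 * #|core|)%N.
Proof.
have := sum_deg unicyclic_e.1; rewrite unicyclic_e.2.2.
rewrite (bigID (mem core)) /= (eq_bigr (fun v => core_deg v + leaf_deg v)%N); last first.
  by move=> v _; rewrite deg_split.
rewrite big_split /= (eq_bigr (fun=> 1%N) (P := fun v => v \notin core)); last first.
  by move=> v; have := deg_gt0 v; rewrite inE -leqNgt; lia.
have -> : (\sum_(v | v \notin core) 1 = #|~: core|)%N.
  by rewrite -sum1_card; apply: eq_bigl => v; rewrite in_setC.
have := sum_leaf_deg; have := cardsC core; rewrite card_ord /reverse_coercion /=; lia.
Qed.

Lemma sum_core_reduced_deg : (\sum_(v in core) (deg e v).-1 = n)%N.
Proof.
have : (\sum_(v in core) (deg e v).-1 + \sum_(v in core) 1 =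
        \sum_(v in core) core_deg v + \sum_(v in core) leaf_deg v)%N.
  rewrite -!big_split /=; apply: eq_bigr => v _; rewrite -deg_split.
  by have := deg_gt0 v; lia.
have := sum_leaf_deg; have := sum_core_deg; rewrite sum1_card; lia.
Qed.

Lemma core_deg_leaf_deg_gt1 v : v \in core -> (1 < core_deg v + leaf_deg v)%N.
Proof. by rewrite inE deg_split. Qed.

(** Otherwise v and its leaves form a closed set, the graph is a star with core {v}, and the core
    degrees sum to 0 instead of 2. *)
Lemma core_deg_gt0 v : v \in core -> (0 < core_deg v)%N.
Proof.
move=> vC; rewrite lt0n; apply/negP => /eqP v0.
have leafP u : e v u -> u \notin core.
  move=> evu; apply/negP => uC; move/eqP: v0; rewrite cards_eq0 => /eqP /setP /(_ u).
  by rewrite !inE evu; move: uC; rewrite inE => ->.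
have core1 : core = [set v].
  apply/eqP; rewrite eqEsubset sub1set vC andbT; apply/subsetP => u uC.
  have cl x w : x \in v |: [set u | e v u] -> e x w -> w \in v |: [set u | e v u].
    rewrite !inE => /orP[/eqP->->|evx exw]; first exact: orbT.
    have xC := leafP _ evx; rewrite e_sym in evx.
    by rewrite (leaf_neighbour_uniq xC evx exw) eqxx.
  have /setP/(_ u) := closed_setT (setU11 _ _) cl.
  by rewrite !inE; case: eqP => //= _ /leafP; rewrite uC.
by have := sum_core_deg; rewrite core1 big_set1 cards1 v0.
Qed.

End Core.

(** * Graphs described by a finite shape, isomorphism and the value of RRR *)

Section Isomorphism.
Variable n : nat.

(** The list is completed to an enumeration of all vertices and f is the position there; [index]
    sends every vertex outside r to [size r]. *)
Lemma index_perm (r : seq 'I_n) : uniq r ->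
  exists f : {perm 'I_n}, forall x, index x r = minn (f x) (size r).
Proof.
move=> ur; set t := r ++ [seq x <- enum 'I_n | x \notin r].
have mt x : x \in t by rewrite mem_cat mem_filter mem_enum andbT orbN.
have ut : uniq t.
  rewrite cat_uniq ur filter_uniq ?enum_uniq ?andbT //=.
  by apply/hasPn => x; rewrite mem_filter => /andP[].
have st : size t = n.
  rewrite -[RHS]card_ord cardE; apply: perm_size; apply: uniq_perm => //.
    exact: enum_uniq.
  by move=> x; rewrite mt mem_enum.
have lt x : (index x t < n)%N by rewrite -[X in (_ < X)%N]st index_mem.
have inj : injective (fun x => Ordinal (lt x)).
  move=> x y /(congr1 val) /= xy.
  by rewrite -(nth_index x (mt x)) xy nth_index.
exists (perm inj) => x; rewrite permE /= index_cat.
case: ifP => [xr|/negbT xr]; last by rewrite (memNindex xr) (minn_idPr _) ?leq_addr.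
by rewrite (minn_idPl _) // ltnW // index_mem.
Qed.

(** A shape h lives on 0, ..., k, where k stands for every leaf at once. Listing the core in the
    right order is then enough to obtain an isomorphism. *)
Lemma shape_isomorphic (e g : rel 'I_n) (h : rel nat) (k : nat) (r : seq 'I_n) :
  (forall x y, g x y = h (minn x k) (minn y k)) -> uniq r -> size r = k ->
  (forall x y, e x y = h (index x r) (index y r)) -> isomorphic e g.
Proof.
move=> gE /index_perm[f fE] sr eE; exists f => x y.
by rewrite gE eE !fE sr.
Qed.

Lemma isomorphic_simple (e g : rel 'I_n) :
  isomorphic e g -> simple_graph e -> simple_graph g.
Proof.
case=> f fE [es ei]; split=> [x y|x]; last by rewrite -(permKV f x) -fE ei.
by rewrite -(permKV f x) -(permKV f y) -!fE es.
Qed.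

Lemma isomorphic_RRR (R : rcfType) (e g : rel 'I_n) :
  simple_graph e -> isomorphic e g -> RRR R e = RRR R g.
Proof.
move=> se eg; have sg := isomorphic_simple eg se; case: eg => f fE.
have dE x : deg e x = deg g (f x).
  rewrite !degE [RHS](reindex_inj (@perm_inj _ f)) /=.
  by apply: eq_bigl => y; rewrite fE.
apply/eqP; rewrite -(eqr_pMn2r (ltn0Sn 1)); apply/eqP; rewrite !RRR_double //.
rewrite [RHS](reindex_inj (@perm_inj _ f)) /=; apply: eq_bigr => x _.
rewrite [RHS](reindex_inj (@perm_inj _ f)) /=.
by apply: eq_big => [y|y _]; rewrite ?fE ?dE.
Qed.

Lemma big_min_ord (V : nmodType) (F : nat -> V) k : (k <= n)%N ->
  \sum_(x < n) F (minn x k) = \sum_(i < k) F i + F k *+ (n - k).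
Proof.
move=> kn; rewrite -(big_mkord xpredT (fun i => F (minn i k))) /=.
rewrite (big_cat_nat (leq0n k) kn) /=; congr (_ + _).
  rewrite big_mkord; apply: eq_bigr => i _.
  by rewrite (minn_idPl _) // ltnW.
rewrite -sumr_const_nat; apply: eq_big_nat => i /andP[ki _].
by rewrite (minn_idPr _).
Qed.

Lemma big_min_ord_nat (F : nat -> nat) k : (k <= n)%N ->
  (\sum_(x < n) F (minn x k) = \sum_(i < k) F i + F k * (n - k))%N.
Proof.
move=> kn; rewrite -(big_mkord xpredT (fun i => F (minn i k))) /=.
rewrite (big_cat_nat (leq0n k) kn) /=; congr (_ + _)%N.
  rewrite big_mkord; apply: eq_bigr => i _.
  by rewrite (minn_idPl _) // ltnW.
rewrite mulnC -sum_nat_const_nat; apply: eq_big_nat => i /andP[ki _].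
by rewrite (minn_idPr _).
Qed.

Lemma shape_deg (g : rel 'I_n) (h : rel nat) k : (k <= n)%N ->
  (forall x y, g x y = h (minn x k) (minn y k)) ->
  forall x, deg g x =
    (\sum_(j < k) h (minn x k) j + h (minn x k) k * (n - k))%N.
Proof.
move=> kn gE x; rewrite degE big_mkcond /=.
rewrite -(@big_min_ord_nat (fun j => h (minn x k) j : nat)) //.
by apply: eq_bigr => y _; rewrite gE; case: (h _ _).
Qed.

(** Position k has reduced degree 0, so pairs with a leaf contribute nothing and a sum over the k
    listed vertices remains, which can be computed. *)
Lemma shape_RRR (R : rcfType) (g : rel 'I_n) (h : rel nat) (rho : nat -> nat) k :
  (k <= n)%N -> simple_graph g ->
  (forall x y, g x y = h (minn x k) (minn y k)) ->
  (forall i, (i <= k)%N ->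
     (\sum_(j < k) h i j + h i k * (n - k))%N.-1 = rho i) ->
  rho k = 0%N ->
  RRR R g *+ 2 =
  \sum_(i < k) \sum_(j < k) (h i j)%:R * (sqrtn R (rho i) * sqrtn R (rho j)).
Proof.
move=> kn sg gE rhoE rho0.
have dE x : (deg g x).-1 = rho (minn x k) by rewrite (shape_deg kn gE) rhoE ?geq_minr.
pose G i j := (h i j)%:R * (sqrtn R (rho i) * sqrtn R (rho j)).
have Gk i : G i k = 0 by rewrite /G rho0 sqrtn0 !mulr0.
have kG j : G k j = 0 by rewrite /G rho0 sqrtn0 mul0r mulr0.
rewrite RRR_double //.
transitivity (\sum_(x < n) \sum_(y < n) G (minn x k) (minn y k)).
  apply: eq_bigr => x _; rewrite big_mkcond /=; apply: eq_bigr => y _.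
  by rewrite /G gE !dE; case: (h _ _); rewrite ?mul1r ?mul0r.
rewrite (big_min_ord (fun i => \sum_(y < n) G i (minn y k))) //.
rewrite [X in _ + X *+ _]big1 ?mul0rn ?addr0 => [|y _]; last exact: kG.
by apply: eq_bigr => i _; rewrite (big_min_ord (G i)) // Gk mul0rn addr0.
Qed.

Lemma Splus_min (x y : 'I_n) : Splus x y = Splus_rel (minn x 3) (minn y 3).
Proof.
rewrite /Splus; case: x y => [[|[|[|x]]] hx] [[|[|[|y]]] hy] //=;
  rewrite /Splus_rel ?minnSS ?minn0 /=; lia.
Qed.

Definition H_rel : rel nat := fun i j => H_half i j || H_half j i.

Lemma Hn_min (x y : 'I_n) : Hn x y = H_rel (minn x 5) (minn y 5).
Proof.
rewrite /Hn /H_rel; case: x y => [[|[|[|[|[|x]]]]] hx] [[|[|[|[|[|y]]]]] hy] //=;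
  rewrite ?minnSS ?minn0 /=; try lia.
Qed.

End Isomorphism.

(** * From the linearised bound to RRR, and the extremal cores *)

Section CoreBounds.
Variables (R : rcfType) (n : nat) (e : rel 'I_n).
Hypothesis n_ge4 : (4 <= n)%N.
Hypothesis unicyclic_e : unicyclic e.

Let e_sym : symmetric e := unicyclic_e.1.1.
Let e_irr : irreflexive e := unicyclic_e.1.2.

Notation C := (core e).
Notation cdeg := (core_deg e).
Notation ldeg := (leaf_deg e).
Notation B := (branching C cdeg).
Notation M := (subdividing C cdeg).
Notation s x := (sqrtn R (deg e x).-1).
Let d_gt0 := core_deg_gt0 n_ge4 unicyclic_e.
Let dl_gt1 := @core_deg_leaf_deg_gt1 n e.
Let sum_d := sum_core_deg n_ge4 unicyclic_e.
Let sum_l := sum_leaf_deg n_ge4 unicyclic_e.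

Lemma RRR_core :
  RRR R e *+ 2 = \sum_(x in C) \sum_(y in C | e x y) s x * s y.
Proof.
rewrite RRR_double ?unicyclic_e.1 //.
have s0 x : x \notin C -> s x = 0.
  by rewrite inE -leqNgt => x1; rewrite (_ : (deg e x).-1 = 0%N) ?sqrtn0 //; lia.
rewrite (bigID (mem C)) /= [X in _ + X]big1 ?addr0 => [|x xC]; last first.
  by apply: big1 => y _; rewrite s0 // mul0r.
apply: eq_bigr => x _; rewrite (bigID (mem C)) /= [X in _ + X]big1 ?addr0.
  by apply: eq_bigl => y; rewrite andbC.
by move=> y /andP[_ yC]; rewrite [s y]s0 // mulr0.
Qed.

Lemma core_degE x : cdeg x = (\sum_(y in C | e x y) 1)%N.
Proof. by rewrite /core_deg -sum1_card; apply: eq_bigl => y; rewrite inE. Qed.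

(** The exact error of the linearisation, doubled because each core edge occurs in both orders. *)
Lemma RRR_sub_linear_bound :
  (RRR R e - linear_bound R C cdeg ldeg) *+ 2 =
  \sum_(x in C) \sum_(y in C | e x y) (s x - 1) * (s y - 1).
Proof.
rewrite mulrnBl RRR_core.
have E1 : \sum_(x in C) \sum_(y in C | e x y) s x = \sum_(x in C) (cdeg x)%:R * s x.
  by apply: eq_bigr => x _; rewrite core_degE natr_sum mulr_suml;
    apply: eq_bigr => y _; rewrite mul1r.
have E2 : \sum_(x in C) \sum_(y in C | e x y) s y = \sum_(x in C) (cdeg x)%:R * s x.
  rewrite -E1 (exchange_big_dep (mem C)) /=; last by move=> x y _ /andP[].
  by apply: eq_bigr => y yC; apply: eq_bigl => x; rewrite e_sym yC.
have E3 : \sum_(x in C) \sum_(y in C | e x y) 1 = (#|C|%:R *+ 2 : R).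
  rewrite -mulr_natl -natrM -sum_d natr_sum; apply: eq_bigr => x _.
  by rewrite core_degE natr_sum.
have -> : linear_bound R C cdeg ldeg = \sum_(x in C) (cdeg x)%:R * s x - #|C|%:R.
  rewrite -sumr_const -sumrB; apply: eq_bigr => x _.
  by rewrite deg_split.
transitivity (\sum_(x in C) (\sum_(y in C | e x y) s x * s y
  - \sum_(y in C | e x y) s x - \sum_(y in C | e x y) s y + \sum_(y in C | e x y) 1)).
  by rewrite big_split /= E3 !sumrB E1 E2; ring.
apply: eq_bigr => x _; rewrite -!sumrB -big_split /=; apply: eq_bigr => y _; ring.
Qed.

Lemma core_sqrt_ge1 x : x \in C -> 1 <= s x.
Proof. by rewrite inE => x1; apply: sqrtn_ge1; lia. Qed.

Lemma linear_bound_le : linear_bound R C cdeg ldeg <= RRR R e.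
Proof.
rewrite -subr_ge0 -(pmulrn_lge0 _ (ltn0Sn 1)) RRR_sub_linear_bound.
apply: sumr_ge0 => x /core_sqrt_ge1 x1; apply: sumr_ge0 => y /andP[/core_sqrt_ge1 y1 _].
by rewrite mulr_ge0 // subr_ge0.
Qed.

(** The summand of the edge xy in the error is positive when both reduced degrees exceed 1. This
    later shows that in the extremal case y is not adjacent to the end v of the path. *)
Lemma linear_bound_lt x y : x \in C -> y \in C -> e x y ->
  (2 < deg e x)%N -> (2 < deg e y)%N -> linear_bound R C cdeg ldeg < RRR R e.
Proof.
move=> xC yC exy dx dy.
rewrite -subr_gt0 -(pmulrn_lgt0 _ (ltn0Sn 1)) RRR_sub_linear_bound.
have ge0 u w : u \in C -> w \in C -> 0 <= (s u - 1) * (s w - 1).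
  by move=> /core_sqrt_ge1 u1 /core_sqrt_ge1 w1; rewrite mulr_ge0 // subr_ge0.
rewrite (bigD1 x) //= (bigD1 y) ?yC //= -addrA ltr_wpDr //.
  apply: addr_ge0; first by apply: sumr_ge0 => w /andP[/andP[wC _] _]; exact: ge0.
  by apply: sumr_ge0 => u /andP[uC _]; apply: sumr_ge0 => w /andP[wC _]; exact: ge0.
by rewrite mulr_gt0 // subr_gt0 -(sqrtn1 R) ltr_sqrtn; lia.
Qed.

Lemma core_deg_lt v : v \in C -> (cdeg v < #|C|)%N.
Proof.
move=> vC; rewrite (cardsD1 v C) vC add1n ltnS; apply: subset_leq_card.
apply/subsetP => u; rewrite in_setD1 in_set => /andP[-> evu].
by rewrite andbT; apply/eqP => uv; rewrite uv e_irr in evu.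
Qed.

Lemma core_card_ge3 : (3 <= #|C|)%N.
Proof.
have C0 : (0 < #|C|)%N.
  rewrite lt0n cards_eq0; apply/eqP => C0.
  by have := sum_l; rewrite C0 cards0 big_set0; lia.
have : (\sum_(v in C) cdeg v <= \sum_(v in C) #|C|.-1)%N.
  by apply: leq_sum => v /core_deg_lt; lia.
rewrite sum_d sum_nat_const; nia.
Qed.

(** [card_core] gives |C| = d - 1 + |M|, and the core degree d of y is less than |C|. *)
Lemma subdividing_ge2 y : B = [set y] -> (2 <= #|M|)%N.
Proof.
move=> By; have yB : y \in B by rewrite By set11.
have yC : y \in C by move: yB; rewrite in_set => /andP[].
have := card_core d_gt0 sum_d; rewrite By big_set1.
by have := core_deg_lt yC; have := d_gt0 yC; rewrite /reverse_coercion /=; lia.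
Qed.

Lemma core_seq (r : seq 'I_n) :
  uniq r -> {subset r <= C} -> #|C| = size r -> C =i r.
Proof.
move=> ur rC cC x; have := @uniq_min_size _ r (enum C) ur.
case=> [u /rC|| _ rE]; [by rewrite mem_enum | by rewrite -cardE cC |].
by rewrite rE mem_enum.
Qed.

Lemma core_deg_seq r x : uniq r -> C =i r -> cdeg x = (\sum_(u <- r) e x u)%N.
Proof.
move=> ur rC; rewrite core_degE big_mkcondr /= (eq_bigl (mem r)) //.
by rewrite -big_uniq //; apply: eq_bigr => u _; case: (e x u).
Qed.

Lemma RRR_seq r : uniq r -> C =i r ->
  RRR R e *+ 2 = \sum_(x <- r) \sum_(y <- r | e x y) s x * s y.
Proof.
move=> ur rC; rewrite RRR_core (eq_bigl (mem r)) // -big_uniq //=.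
apply: eq_bigr => x _; rewrite big_mkcondr /= (eq_bigl (mem r)) //.
by rewrite -big_uniq //= -big_mkcond.
Qed.

Lemma core_deg_neq x u : cdeg x != cdeg u -> x != u.
Proof. by apply: contraNneq => ->. Qed.

Lemma leaf_adjacent c : (forall v, v \in C -> v != c -> ldeg v = 0%N) ->
  forall x u, u \notin C -> e x u = (x == c).
Proof.
move=> lc.
have adj x u : u \notin C -> e x u -> x = c.
  move=> uC exu; apply/eqP/negPn/negP => xc.
  have xC : x \in C by apply: (leaf_neighbour n_ge4 unicyclic_e uC); rewrite e_sym.
  have := lc _ xC xc; move/eqP; rewrite cards_eq0 => /eqP/setP/(_ u).
  by rewrite in_set in_setC uC exu in_set0.
move=> x u uC; apply/idP/eqP => [|->]; first exact: adj.
have /card_gt0P[w] := deg_gt0 n_ge4 unicyclic_e u.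
by rewrite inE e_sym => ewu; rewrite -(adj _ _ uC ewu).
Qed.

(** The core is a triangle y, a, b with a pendent edge yv. The edge ab contributes at least 1, and
    the surplus reduced degrees of a, b, v are merged into a single root multiplied by that of y. *)
Lemma paw_core_bound y : B = [set y] -> cdeg y = 3%N -> #|M| = 2%N ->
  exists t q, [/\ (2 <= t)%N, (0 < q)%N, (t + q = n - 2)%N &
    1 + sqrtn R t * (2 + sqrtn R q) <= RRR R e].
Proof.
move=> By dy M2; have yB : y \in B by rewrite By set11.
have cC : #|C| = 4%N by rewrite (card_core d_gt0 sum_d) By big_set1 dy M2.
have /cards2P[a [b [ab ME]]] : #|M| == 2%N by rewrite M2.
have aM : a \in M by rewrite ME set21.
have bM : b \in M by rewrite ME set22.
(* The core has four vertices but only three of core degree at least 2. *)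
have /subsetPn[v vC vBM] : ~~ (C \subset B :|: M).
  apply/negP => /subset_leq_card; rewrite cC.
  by have := (leq_card_setU B M).1; rewrite By cards1 M2; lia.
move: vBM; rewrite in_setU negb_or => /andP[vB vM].
have [yC _] : y \in C /\ (2 < cdeg y)%N by move: yB; rewrite in_set => /andP[].
have [aC da] : a \in C /\ cdeg a = 2%N by move: aM; rewrite in_set => /andP[? /eqP].
have [bC db] : b \in C /\ cdeg b = 2%N by move: bM; rewrite in_set => /andP[? /eqP].
have dv : cdeg v = 1%N.
  by move: vB vM; rewrite in_set vC /= in_set vC /=; have := d_gt0 vC;
    case: (cdeg v) => [|[|[]]].
have ur : uniq [:: y; a; b; v].
  by rewrite /= !inE !negb_or ab !core_deg_neq ?dy ?da ?db ?dv.
have rC : C =i [:: y; a; b; v].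
  apply: core_seq => //; apply/allP; by rewrite /= yC aC bC vC.
have sr := sum_core_reduced_deg n_ge4 unicyclic_e.
rewrite (eq_bigl (mem [:: y; a; b; v])) // -big_uniq //= !big_cons big_nil in sr.
have := core_deg_seq y ur rC; have := core_deg_seq a ur rC.
have := core_deg_seq b ur rC; have := core_deg_seq v ur rC.
rewrite dy da db dv !big_cons !big_nil !e_irr.
rewrite (e_sym a y) (e_sym b y) (e_sym b a) (e_sym v y) (e_sym v a) (e_sym v b).
have := RRR_seq ur rC; rewrite !big_cons !big_nil !e_irr.
rewrite (e_sym a y) (e_sym b y) (e_sym b a) (e_sym v y) (e_sym v a) (e_sym v b).
(* The four core degrees determine all six adjacencies: the edges are ya, yb, yv and ab. *)
case: (e y a) => //; case: (e y b) => //; case: (e y v) => //; case: (e a b) => //;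
  case: (e a v) => //; case: (e b v) => //= RE _ _ _ _.
have dgt x : x \in C -> (0 < (deg e x).-1)%N by rewrite inE; case: (deg e x) => [|[]].
have := dgt _ aC; have := dgt _ bC; have := dgt _ vC => v1 b1 a1.
have y2 : (2 <= (deg e y).-1)%N by rewrite deg_split dy.
move: RE v1 b1 a1 y2 sr.
move: (deg e y).-1 (deg e a).-1 (deg e b).-1 (deg e v).-1 => t i j k RE k1 j1 i1 t2 sr.
(* q = i + j + k - 2, and t + i + j + k = n by [sum_core_reduced_deg]. *)
exists t, (i.-1 + j.-1 + k.-1).+1; split=> //; first by clear -k1 j1 i1 sr; lia.
have := sqrtn_merge R (i.-1 + j.-1) k.-1; have := sqrtn_merge R i.-1 j.-1.
rewrite !prednK // => h1 h2.
have i1R := sqrtn_ge1 R i1; have j1R := sqrtn_ge1 R j1; have t0R := sqrtn_ge0 R t.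
have ij : 1 <= sqrtn R i * sqrtn R j by rewrite mulr_ege1.
have : sqrtn R t * (2 + sqrtn R (i.-1 + j.-1 + k.-1).+1) <=
       sqrtn R t * (sqrtn R i + sqrtn R j + sqrtn R k) by rewrite ler_wpM2l //; lra.
lra.
Qed.

Lemma cycle_core_shape : RRR R e = 1 + 2 * sqrtn R (n - 2) -> B = set0 ->
  exists r : seq 'I_n, [/\ uniq r, size r = 3%N &
    forall x u, e x u = Splus_rel (index x r) (index u r)].
Proof.
move=> RE B0.
have [h1 h2] := cycle_bound R sum_d sum_l B0 core_card_ge3.
have [cC l0] : #|C| = 3%N /\ forall u v, u \in C -> v \in C -> u != v ->
    ldeg u = 0%N \/ ldeg v = 0%N.
  by apply: h2; apply/eqP; rewrite eq_le h1 andbT -RE linear_bound_le.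
(* The core has three vertices and n >= 4, so some leaf exists; all leaves then hang at z. *)
have [z zC lz] : exists2 z, z \in C & (0 < ldeg z)%N.
  have [z /andP[zC lz]|l00] := pickP [pred z in C | 0 < ldeg z]%N; first by exists z.
  have := sum_l; rewrite cC big1 => [|v vC]; first by lia.
  by have := l00 v; rewrite /= vC /=; lia.
have /cards2P[a [b [ab CE]]] : #|C :\ z| == 2%N.
  by have := cardsD1 z C; rewrite cC zC; lia.
have : a \in C :\ z by rewrite CE set21.
have : b \in C :\ z by rewrite CE set22.
rewrite !in_setD1 => /andP[bz bC] /andP[az aC].
have ur : uniq [:: z; a; b] by rewrite /= !inE !negb_or ab eq_sym az eq_sym bz.
have rC : C =i [:: z; a; b].
  by apply: core_seq => //; apply/allP; rewrite /= zC aC bC.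
have lc v : v \in C -> v != z -> ldeg v = 0%N.
  by move=> vC vz; have [//|l0z] := l0 _ _ vC zC vz; rewrite l0z in lz.
have d1 := core_deg_lt zC; have d2 := core_deg_lt aC; have d3 := core_deg_lt bC.
have := sum_d; rewrite (eq_bigl (mem [:: z; a; b])) // -big_uniq //= !big_cons big_nil cC.
have := core_deg_seq z ur rC; have := core_deg_seq a ur rC; have := core_deg_seq b ur rC.
rewrite !big_cons !big_nil !e_irr (e_sym a z) (e_sym b z) (e_sym b a) => -> -> ->.
(* The core degrees sum to 6, so all three pairs are edges. The centre z is listed first to match
   [Splus_rel]. *)
case eza: (e z a); case ezb: (e z b); case eab: (e a b) => // _ {d1 d2 d3}.
exists [:: z; a; b]; split=> // x u.
have la := leaf_adjacent lc.
have [xC|xC] := boolP (x \in C); have [uC|uC] := boolP (u \in C).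
- move: xC uC; rewrite !rC !inE => /or3P[]/eqP-> /or3P[]/eqP->;
  by rewrite /= ?eqxx ?(negPf az) ?(negPf bz) ?(negPf ab) ?(eq_sym z) ?(eq_sym b a)
    ?(negPf az) ?(negPf bz) ?(negPf ab) ?e_irr ?(e_sym a z) ?(e_sym b) ?eza ?ezb ?eab.
- rewrite la //; rewrite rC in uC; rewrite (memNindex uC) /=.
  by move: xC; rewrite rC eq_sym; case: eqP => //= _; case: eqP => //= _; case: eqP.
- rewrite e_sym la //; rewrite rC in xC; rewrite (memNindex xC) /=.
  by move: uC; rewrite rC eq_sym; case: eqP => //= _; case: eqP => //= _; case: eqP.
rewrite la //; rewrite rC in uC; rewrite (memNindex uC); rewrite rC in xC.
by rewrite (memNindex xC); apply: contraNF xC => /eqP->; rewrite inE eqxx.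
Qed.

(** Equality holds in the linearisation and in [branching_bound]. The core then consists of y, three
    vertices of core degree 2 and one vertex v of core degree 1 that carries all leaves; it remains
    to locate v. *)
Lemma branching_core_shape : (17 <= n)%N ->
  RRR R e = 1 + 3 * sqrtn R 2 + sqrtn R (n - 5) -> B != set0 ->
  (forall y, B = [set y] -> cdeg y = 3%N -> (3 <= #|M|)%N) ->
  exists r : seq 'I_n, [/\ uniq r, size r = 5%N & forall x u,
    e x u = H_rel (index x r) (index u r)].
Proof.
move=> n17 RE B0 M3.
have [h1 h2] := branching_bound R d_gt0 dl_gt1 sum_d sum_l B0 subdividing_ge2 M3.
have LE : linear_bound R C cdeg ldeg = RRR R e.
  by apply/eqP; rewrite eq_le linear_bound_le RE h1.
have [y [By dy M3E l0]] := h2 (etrans LE RE).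
have yB : y \in B by rewrite By set11.
have [yC _] : y \in C /\ (2 < cdeg y)%N by move: yB; rewrite in_set => /andP[].
have cC : #|C| = 5%N by rewrite (card_core d_gt0 sum_d) By big_set1 dy M3E.
have /subsetPn[v vC vBM] : ~~ (C \subset B :|: M).
  apply/negP => /subset_leq_card; rewrite cC => CB.
  by have := leq_trans CB (leq_card_setU B M).1; rewrite By cards1 M3E.
move: vBM; rewrite in_setU negb_or => /andP[vB vM].
have dv : cdeg v = 1%N.
  by move: vB vM; rewrite in_set vC /= in_set vC /=; have := d_gt0 vC;
    case: (cdeg v) => [|[|[]]].
have MC x : x \in M -> x \in C /\ cdeg x = 2%N by rewrite in_set => /andP[? /eqP].
have CE : v |: (y |: M) = C.
  apply/eqP; rewrite eqEcard cC !cardsU1 M3E.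
  have -> : y \notin M by apply/negP => /MC[_]; rewrite dy.
  have -> : v \notin y |: M by rewrite in_setU1 (negPf vM) orbF -in_set1 -By.
  rewrite andbT; apply/subsetP => x /setU1P[->//|/setU1P[->//|/MC[]//]].
have dC x : x \in C -> x != v -> x = y \/ x \in M.
  move=> xC; have : x \in v |: (y |: M) by rewrite CE.
  by case/setU1P=> [->|/setU1P[|]]; [rewrite eqxx | left | right].
have lc x : x \in C -> x != v -> ldeg x = 0%N.
  by move=> xC /(dC _ xC)[xy|/MC[_ dx]]; apply: l0; rewrite // ?xy ?dy ?dx.
(* v carries n - 5 leaves, so an edge yv would make the linearisation strict. *)
have eyv : e y v = false.
  apply/negP => eyv; suff : linear_bound R C cdeg ldeg < RRR R e by rewrite LE ltxx.
  apply: (linear_bound_lt yC vC eyv); rewrite deg_split ?dy // dv.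
  have := sum_l; rewrite cC (bigD1 v) //= big1 => [|x /andP[xC xv]]; last exact: lc.
  by clear -n17; lia.
have [w wC evw] : exists2 w, w \in C & e v w.
  have /card_gt0P[w] := d_gt0 vC; rewrite in_set => /andP[wC evw]; by exists w.
have wv : w != v by apply: contraTneq evw => ->; rewrite e_irr.
have wM : w \in M.
  by case: (dC _ wC wv) => // wy; move: evw; rewrite wy e_sym eyv.
have /cards2P[a [b [ab ME]]] : #|M :\ w| == 2%N.
  by have := cardsD1 w M; rewrite M3E wM => -[->].
have : a \in M :\ w by rewrite ME set21.
have : b \in M :\ w by rewrite ME set22.
rewrite !in_setD1 => /andP[bw bM] /andP[aw aM].
have [[_ dw] [aC da] [bC db]] := And3 (MC _ wM) (MC _ aM) (MC _ bM).
have ur : uniq [:: y; a; b; w; v].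
  by rewrite /= !inE !negb_or ab aw bw !core_deg_neq ?dy ?da ?db ?dv ?dw.
have rC : C =i [:: y; a; b; w; v].
  by apply: core_seq => //; apply/allP; rewrite /= yC aC bC wC vC.
have := core_deg_seq y ur rC; have := core_deg_seq a ur rC.
have := core_deg_seq b ur rC; have := core_deg_seq w ur rC; have := core_deg_seq v ur rC.
rewrite dy da db dv dw !big_cons !big_nil !e_irr eyv evw (e_sym v y) eyv (e_sym w v) evw.
rewrite (e_sym a y) (e_sym b y) (e_sym b a) (e_sym w y) (e_sym w a) (e_sym w b).
rewrite (e_sym v a) (e_sym v b).
(* Since v hangs at w and not at y, the core degrees force y to be adjacent to a, b, w and a to b.
   The list below follows the numbering of [H_half]. *)
case eya: (e y a) => //; case eyb: (e y b) => //; case eyw: (e y w) => //.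
case eav: (e a v) => //; case ebv: (e b v) => //.
case eab: (e a b) => //; case eaw: (e a w) => //; case ebw: (e b w) => // _ _ _ _ _.
exists [:: y; a; b; w; v]; split=> // x u; rewrite /H_rel.
have la := leaf_adjacent lc.
have iy : index y [:: y; a; b; w; v] = 0%N
  := @index_uniq _ y 0 [:: y; a; b; w; v] isT ur.
have ia : index a [:: y; a; b; w; v] = 1%N
  := @index_uniq _ y 1 [:: y; a; b; w; v] isT ur.
have ib : index b [:: y; a; b; w; v] = 2%N
  := @index_uniq _ y 2 [:: y; a; b; w; v] isT ur.
have iw : index w [:: y; a; b; w; v] = 3%N
  := @index_uniq _ y 3 [:: y; a; b; w; v] isT ur.
have iv : index v [:: y; a; b; w; v] = 4%N
  := @index_uniq _ y 4 [:: y; a; b; w; v] isT ur.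
have mixed z t : z \in C -> t \notin C -> e z t =
    H_half (index z [:: y; a; b; w; v]) (index t [:: y; a; b; w; v]) ||
    H_half (index t [:: y; a; b; w; v]) (index z [:: y; a; b; w; v]).
  move=> zC tC; rewrite la //; rewrite rC in tC; rewrite (memNindex tC).
  move: zC; rewrite rC !inE.
  case/or4P=> [||| /orP[]] /eqP ->; rewrite ?iy ?ia ?ib ?iw ?iv ?eqxx //=;
  by apply/negP => /eqP E; move: dy da db dw; rewrite E dv.
have [xC|xC] := boolP (x \in C); have [uC|uC] := boolP (u \in C).
- move: xC uC; rewrite !rC !inE.
  case/or4P=> [||| /orP[]] /eqP -> /or4P[||| /orP[]] /eqP ->;
  rewrite ?iy ?ia ?ib ?iw ?iv ?e_irr ?eya ?eyb ?eyw ?eyv ?eab ?eaw ?eav ?ebw ?ebv ?evw //;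
  by rewrite e_sym ?eya ?eyb ?eyw ?eyv ?eab ?eaw ?eav ?ebw ?ebv ?evw.
- exact: mixed.
- by rewrite e_sym mixed // orbC.
rewrite la //; rewrite rC in uC; rewrite (memNindex uC); rewrite rC in xC.
by rewrite (memNindex xC); apply: contraNF xC => /eqP->; rewrite !inE eqxx !orbT.
Qed.

End CoreBounds.

(** * Values at the extremal graphs and the final comparison *)

Lemma RRR_Splus (R : rcfType) (n : nat) : (4 <= n)%N ->
  simple_graph (@Splus n) -> RRR R (@Splus n) = 1 + 2 * sqrtn R (n - 2).
Proof.
(* The reduced degrees by position, with 0 for the leaves at the end. *)
move=> n4 sg; pose rho i := nth 0%N [:: n - 2; 1; 1; 0]%N i.
have rhoE i : (i <= 3)%N ->
    (\sum_(j < 3) Splus_rel i j + Splus_rel i 3 * (n - 3))%N.-1 = rho i.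
  rewrite !big_ord_recl big_ord0 /rho.
  by case: i => [|[|[|[|//]]]] _ /=; rewrite /bump /Splus_rel /= ?addn0; lia.
apply/eqP; rewrite -(eqr_pMn2r (ltn0Sn 1)); apply/eqP.
rewrite (shape_RRR R _ sg (@Splus_min n) rhoE) //; last by lia.
rewrite !big_ord_recl !big_ord0 /bump /Splus_rel /= sqrtn1; ring.
Qed.

Lemma RRR_Hn (R : rcfType) (n : nat) : (6 <= n)%N ->
  simple_graph (@Hn n) ->
  RRR R (@Hn n) = 1 + 3 * sqrtn R 2 + sqrtn R (n - 5).
Proof.
move=> n6 sg; pose rho i := nth 0%N [:: 2; 1; 1; 1; n - 5; 0]%N i.
have rhoE i : (i <= 5)%N ->
    (\sum_(j < 5) H_rel i j + H_rel i 5 * (n - 5))%N.-1 = rho i.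
  rewrite !big_ord_recl big_ord0 /rho.
  by case: i => [|[|[|[|[|[|//]]]]]] _ /=; rewrite /bump /H_rel /H_half /= ?addn0; lia.
apply/eqP; rewrite -(eqr_pMn2r (ltn0Sn 1)); apply/eqP.
rewrite (shape_RRR R _ sg (@Hn_min n) rhoE) //; last by lia.
rewrite !big_ord_recl !big_ord0 /bump /H_rel /H_half /= sqrtn1; ring.
Qed.

(** The cases are a cycle as core, a branching core other than the triangle with a pendent edge, and
    that exceptional core. The bounds hold for every n >= 4; only their comparison depends on the
    range of n. *)
Lemma unicyclic_trichotomy (R : rcfType) (n : nat) (e : rel 'I_n) :
  (4 <= n)%N -> unicyclic e ->
  [\/ [/\ branching (core e) (core_deg e) = set0 &
          1 + 2 * sqrtn R (n - 2) <= RRR R e],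
      [/\ branching (core e) (core_deg e) != set0,
          forall y, branching (core e) (core_deg e) = [set y] ->
            core_deg e y = 3%N -> (3 <= #|subdividing (core e) (core_deg e)|)%N &
          1 + 3 * sqrtn R 2 + sqrtn R (n - 5) <= RRR R e] |
      exists t q, [/\ (2 <= t)%N, (0 < q)%N, (t + q = n - 2)%N &
        1 + sqrtn R t * (2 + sqrtn R q) <= RRR R e]].
Proof.
move=> n4 ue.
have d_gt0 := core_deg_gt0 n4 ue; have dl_gt1 := @core_deg_leaf_deg_gt1 n e.
have sum_d := sum_core_deg n4 ue; have sum_l := sum_leaf_deg n4 ue.
have [B0|B0] := eqVneq (branching (core e) (core_deg e)) set0.
  have [h _] := cycle_bound R sum_d sum_l B0 (core_card_ge3 n4 ue).
  by apply: Or31; split=> //; exact: le_trans h (linear_bound_le R n4 ue).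
have M2 := @subdividing_ge2 n e n4 ue.
case: (pickP [pred y | (branching (core e) (core_deg e) == [set y]) &&
    (core_deg e y == 3%N) && (#|subdividing (core e) (core_deg e)| == 2%N)]).
  move=> y /andP[/andP[/eqP By /eqP dy] /eqP M2E].
  exact/Or33/(paw_core_bound R n4 ue By dy M2E).
move=> noP; have M3 y : branching (core e) (core_deg e) = [set y] ->
    core_deg e y = 3%N -> (3 <= #|subdividing (core e) (core_deg e)|)%N.
  move=> By dy; have := noP y; rewrite /= By dy !eqxx /= => /negbT M2E.
  by rewrite ltn_neqAle eq_sym M2E (M2 _ By).
have [h _] := branching_bound R d_gt0 dl_gt1 sum_d sum_l B0 M2 M3.
apply: Or32; split=> //; exact: le_trans h (linear_bound_le R n4 ue).
Qed.

Theorem theorem1 (R : rcfType) (n : nat) (e : rel 'I_n) :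
  (4 <= n)%N -> unicyclic e ->
  ((n <= 16)%N ->
     1 + 2 * Num.sqrt ((n - 2)%N%:R) <= RRR R e /\
     (RRR R e = 1 + 2 * Num.sqrt ((n - 2)%N%:R) <-> isomorphic e (@Splus n))) /\
  ((17 <= n)%N ->
     1 + 3 * Num.sqrt 2 + Num.sqrt ((n - 5)%N%:R) <= RRR R e /\
     (RRR R e = 1 + 3 * Num.sqrt 2 + Num.sqrt ((n - 5)%N%:R) <-> isomorphic e (@Hn n))).
Proof.
move=> n4 ue; rewrite -!/(sqrtn R _).
have tri := unicyclic_trichotomy R n4 ue.
split=> hn.
(* In this range the bounds of the other two cases are strictly larger, so equality forces a cycle
   as core. *)
- have [lb eqB] : 1 + 2 * sqrtn R (n - 2) <= RRR R e /\
      (RRR R e = 1 + 2 * sqrtn R (n - 2) -> branching (core e) (core_deg e) = set0).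
    case: tri => [[B0 h]//|[_ _ h]|[t [q [t2 q0 tq h]]]].
      by have := small_case_gap R hn; split=> [|?]; [|exfalso]; lra.
    have : (t + q <= 14)%N by rewrite tq; lia.
    move=> /(paw_small_case R t2 q0); rewrite tq; clear tq.
    by split=> [|?]; [|exfalso]; lra.
  split=> //; split=> [RE|iso].
    have [r [ur sr eE]] := cycle_core_shape n4 ue RE (eqB RE).
    exact: shape_isomorphic (@Splus_min n) ur sr eE.
  (* That [Splus] is a simple graph is transported from [e] along the isomorphism. *)
  rewrite (isomorphic_RRR R ue.1 iso) RRR_Splus //.
  exact: isomorphic_simple iso ue.1.
(* Now the cycle case and the exceptional core are strictly larger, and equality leaves only H_n. *)
- have [lb eqB] : 1 + 3 * sqrtn R 2 + sqrtn R (n - 5) <= RRR R e /\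
      (RRR R e = 1 + 3 * sqrtn R 2 + sqrtn R (n - 5) -> isomorphic e (@Hn n)).
    case: tri => [[_ h]|[B0 M3 h]|[t [q [t2 q0 tq h]]]].
    + by have := large_case_gap R hn; split=> [|?]; [|exfalso]; lra.
    + split=> // RE; have [r [ur sr eE]] := branching_core_shape n4 ue hn RE B0 M3.
      exact: shape_isomorphic (@Hn_min n) ur sr eE.
    have tq3 : (t + q - 3 = n - 5)%N by lia.
    have : (15 <= t + q)%N by lia.
    move=> /(paw_large_case R t2 q0); rewrite tq3; clear tq tq3.
    by split=> [|?]; [|exfalso]; lra.
  split=> //; split=> // iso.
  rewrite (isomorphic_RRR R ue.1 iso) RRR_Hn //; first by lia.
  exact: isomorphic_simple iso ue.1.
Qed.
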